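(* Let $X=(X_1,\ldots,X_n)$ be a random vector in $\mathbb{R}^n$ whose components $X_1,\dots,X_n$ are independent, each having a symmetric (even) log-concave density on $\mathbb{R}$. Then \[ \mathbb{E}e^{-\Lambda^\ast_X(X)}\leqslant\big(\mathbb{E}e^{-\Lambda^\ast_Y(Y)}\big)^n, \] where $Y$ is a standard double exponential random variable, i.e. with density $\frac12 e^{-|y|}$ on $\mathbb{R}$ (numerically $\mathbb{E}e^{-\Lambda^\ast_Y(Y)}\approx 0.787$).
   Context: For a random vector $Z$ in $\mathbb{R}^n$: $\Lambda_Z(\xi)=\log\mathbb{E}e^{\langle Z,\xi\rangle}$ and $\Lambda_Z^\ast(x)=\sup_{\xi\in\mathbb{R}^n}(\langle x,\xi\rangle-\Lambda_Z(\xi))$ is the Cramér transform; $\mathbb{E}e^{-\Lambda_Z^\ast(Z)}$ denotes the expectation of $e^{-\Lambda_Z^\ast}$ evaluated at $Z$ itself. *)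

(* Defs.v *)
From HB Require Import structures.
From mathcomp Require Import all_boot all_order all_algebra.
From mathcomp Require Import all_classical all_reals all_analysis.
Set Implicit Arguments. Unset Strict Implicit. Unset Printing Implicit Defensive.
Import Order.TTheory GRing.Theory Num.Theory.
Local Open Scope classical_set_scope.
Local Open Scope ring_scope.

Section defs.
Context {R : realType} {d : measure_display} {T : measurableType d}.

(* Mutual independence of a finite family of real random variables
   X_0, ..., X_{n-1}: product rule for all measurable A_0, ..., A_{n-1}
   (taking A_i = setT recovers every subfamily). *)
Definition mutually_independent (P : probability T R) (n : nat)
    (X : 'I_n -> T -> R) : Prop :=
  forall A : 'I_n -> set R, (forall i, measurable (A i)) ->
    P (\bigcap_i (X i @^-1` A i)) = (\prod_i P (X i @^-1` A i))%E.

Definition has_density (P : probability T R) (Z : T -> R) (f : R -> R) : Prop :=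
  measurable_fun setT f /\ (forall x, 0 <= f x) /\
  forall A : set R, measurable A ->
    P (Z @^-1` A) = (\int[lebesgue_measure]_(x in A) (f x)%:E)%E.

(* f is log-concave: log f is concave (with log 0 = -oo), i.e.
   f (t x + (1-t) y) >= f(x)^t f(y)^(1-t) for t in (0,1). *)
Definition log_concave (f : R -> R) : Prop :=
  forall x y t, 0 < t < 1 ->
    f x `^ t * f y `^ (1 - t) <= f (t * x + (1 - t) * y).

Definition even_fun (f : R -> R) : Prop := forall x, f (- x) = f x.

Definition dotn (n : nat) (x y : 'I_n -> R) : R := \sum_i x i * y i.

Definition log_laplace (P : probability T R) (n : nat) (Z : 'I_n -> T -> R)
    (xi : 'I_n -> R) : \bar R :=
  lne ('E_P[fun w => expR (dotn (fun i => Z i w) xi)])%E.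

Definition cramer (P : probability T R) (n : nat) (Z : 'I_n -> T -> R)
    (x : 'I_n -> R) : \bar R :=
  ereal_sup [set ((dotn x xi)%:E - log_laplace P Z xi)%E | xi in [set: 'I_n -> R]].

Definition cramer_functional (P : probability T R) (n : nat)
    (Z : 'I_n -> T -> R) : \bar R :=
  (\int[P]_w expeR (- cramer P Z (fun i => Z i w)))%E.

End defs.

(* Main.v *)
Require Import Defs.
From HB Require Import structures.
From mathcomp Require Import all_boot all_order all_algebra.
From mathcomp Require Import all_classical all_reals all_analysis.
From mathcomp Require Import measurable_realfun ring lra.
Set Implicit Arguments.
Unset Strict Implicit.
Unset Printing Implicit Defensive.
Import Order.TTheory GRing.Theory Num.Theory.
Import numFieldNormedType.Exports.
Local Open Scope classical_set_scope.
Local Open Scope ring_scope.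

(** Let g be the Laplace density and let f be the density of a multiple l X of
    a symmetric log-concave variable X, with l chosen so that f and g have the
    same second moment. On [0, +oo[ the function log f - log g is concave, so
    f - g changes sign there as -, +, - (if at all). If psi is convex on
    [0, +oo[, subtracting from psi (x ^ 2) the chord alpha + beta x ^ 2 through
    the two crossing points yields a function whose product with f - g is
    nonpositive; as the moments of order 0 and 2 agree,
    E psi ((l X) ^ 2) <= E psi (Y ^ 2).
    For psi (s) = 2 cosh (xi sqrt s) this gives
    E e^(xi l X) <= E e^(xi Y) = 1 / (1 - xi ^ 2), hence
    e^(- Lambda_X^* (x)) <= Phi (l x) where Phi = e^(- Lambda_Y^* ). Explicitly
    Phi (y) = (1 + u) / 2 * e^(1 - u) with u = sqrt (1 + y ^ 2), which is again
    a convex function of y ^ 2, so E Phi (l X) <= E Phi (Y).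
    By independence both steps tensorize: the exponents xi_i may be chosen
    separately in each coordinate. *)

(** * Integrals of weighted compositions, densities and independence *)

Section measure_tools.
Context {R : realType}.
Local Open Scope ereal_scope.

(** The integral of a nonnegative function is a supremum over the simple functions below it, which
    is monotone in the integrand. This form suits the integrand of [cramer_functional], a supremum
    over uncountably many [xi] whose measurability is not established here. *)
Lemma ge0_le_integral_nomeas d (T : measurableType d)
    (mu : {measure set T -> \bar R}) (f g : T -> \bar R) :
  (forall x, 0 <= f x) -> (forall x, f x <= g x) ->
  \int[mu]_x f x <= \int[mu]_x g x.
Proof.
move=> f0 fg; have g0 x : 0 <= g x by exact: le_trans (fg x).
rewrite !ge0_integralTE//; apply: ereal_sup_le => _ [h hf <-].
by exists h => // x; exact: le_trans (fg x).
Qed.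

Import HBNNSimple.

(** The hypothesis identifies, on measurable sets, the images under [X1] and [X2] of the measures
    with densities [h1] and [h2]; simple functions and monotone convergence carry this over to
    [phi]. Densities, dilations, reflection and independence are all instances. *)
Lemma ge0_integral_weighted_comp d (S : measurableType d)
    d1 (T1 : measurableType d1) (mu1 : {measure set T1 -> \bar R})
    d2 (T2 : measurableType d2) (mu2 : {measure set T2 -> \bar R})
    (X1 : T1 -> S) (X2 : T2 -> S) (h1 : T1 -> R) (h2 : T2 -> R) (phi : S -> R) :
  measurable_fun setT X1 -> measurable_fun setT X2 ->
  measurable_fun setT h1 -> measurable_fun setT h2 ->
  (forall x, (0 <= h1 x)%R) -> (forall x, (0 <= h2 x)%R) ->
  measurable_fun setT phi -> (forall x, (0 <= phi x)%R) ->
  (forall A : set S, measurable A -> \int[mu1]_x (h1 x * \1_A (X1 x))%:E =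
                             \int[mu2]_x (h2 x * \1_A (X2 x))%:E) ->
  \int[mu1]_x (h1 x * phi (X1 x))%:E = \int[mu2]_x (h2 x * phi (X2 x))%:E.
Proof.
move=> mX1 mX2 mh1 mh2 h10 h20 mphi phi0 H.
have mE : measurable_fun setT (fun x => (phi x)%:E) by exact/measurable_EFinP.
pose p := nnsfun_approx measurableT mE.
(* In this formula the measure, the weight and the map enter only through integrals of indicators,
   which [H] identifies. *)
have lim_p d' (T : measurableType d') (mu : {measure set T -> \bar R})
    (X : T -> S) (h : T -> R) : measurable_fun setT X ->
    measurable_fun setT h -> (forall x, (0 <= h x)%R) ->
    \int[mu]_x (h x * phi (X x))%:E =
    limn (fun n => \sum_(y \in range (p n))
      (y%:E * \int[mu]_x (h x * \1_(p n @^-1` [set y]) (X x))%:E)).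
  move=> mX mh h0.
  have mpX n : measurable_fun setT (fun x => p n (X x)).
    exact: measurableT_comp.
  transitivity (\int[mu]_x limn (fun n => (h x * p n (X x))%:E)).
    apply: eq_integral => x _; apply/esym/cvg_lim => //.
    under eq_fun do rewrite EFinM.
    rewrite EFinM; apply: cvgeZl => //.
    exact: (@cvg_nnsfun_approx _ _ _ _ measurableT _ mE (fun x _ => phi0 x)).
  rewrite monotone_convergence//; last 3 first.
  - by move=> n; apply/measurable_EFinP; exact: measurable_funM.
  - by move=> n x _; rewrite lee_fin mulr_ge0.
  - move=> x _ m n mn; rewrite lee_fin ler_wpM2l//.
    exact/lefP/nd_nnsfun_approx.
  apply: congr_lim; apply/funext => n.
  have mi y : measurable_fun setT (fun x => \1_(p n @^-1` [set y]) (X x) : R).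
    by apply: measurableT_comp => //; exact: measurable_indic.
  have pre0 y : range (p n) y -> (0 <= y)%R by case=> x _ <-.
  transitivity (\int[mu]_x \sum_(y \in range (p n))
      (y * (h x * \1_(p n @^-1` [set y]) (X x)))%:E).
    apply: eq_integral => x _.
    rewrite fsumEFin//; congr EFin.
    rewrite [in LHS]fimfunE mulr_fsumr//.
    by apply: eq_fsbigr => y _; rewrite mulrCA.
  rewrite ge0_integral_fsum//; last 2 first.
  - move=> y; apply/measurable_EFinP.
    by apply: measurable_funM => //; exact: measurable_funM.
  - move=> y x _; rewrite lee_fin mulrCA mulr_ge0//.
    by rewrite -lee_fin EFinM; exact: nnfun_muleindic_ge0.
  apply: eq_fsbigr => y /set_mem ry.
  under eq_integral do rewrite EFinM.
  rewrite ge0_integralZl_EFin//.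
  - by move=> x _; rewrite lee_fin mulr_ge0// indicE.
  - by apply/measurable_EFinP; exact: measurable_funM.
  - exact: pre0.
rewrite (lim_p _ _ mu1 X1 h1)// (lim_p _ _ mu2 X2 h2)//.
apply: congr_lim; apply/funext => n; apply: eq_fsbigr => y _.
by rewrite H.
Qed.


Lemma integral_indic_comp d (T : measurableType d)
    (mu : {measure set T -> \bar R}) d' (S : measurableType d') (X : T -> S)
    (A : set S) : measurable_fun setT X -> measurable A ->
  \int[mu]_w (\1_A (X w) : R)%:E = mu (X @^-1` A).
Proof.
move=> mX mA; have mXA : measurable (X @^-1` A).
  by rewrite -[X in measurable X]setTI; exact: mX.
rewrite -[in RHS](setIT (X @^-1` A)) -integral_indic//.
Qed.

Lemma ge0_expectation_density d (T : measurableType d) (P : probability T R)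
    (X : T -> R) (f phi : R -> R) :
  measurable_fun setT X -> has_density P X f ->
  measurable_fun setT phi -> (forall x, (0 <= phi x)%R) ->
  \int[P]_w (phi (X w))%:E = \int[lebesgue_measure]_x (f x * phi x)%:E.
Proof.
move=> mX [mf [f0 Pf]] mphi phi0.
transitivity (\int[P]_w (1 * phi (X w))%:E).
  by apply: eq_integral => w _; rewrite mul1r.
apply: (@ge0_integral_weighted_comp _ (measurableTypeR R) _ T P
  _ (measurableTypeR R) lebesgue_measure X id (fun=> 1%R) f phi) => //.
move=> A mA; transitivity (P (X @^-1` A)).
  by rewrite -integral_indic_comp//; apply: eq_integral => w _; rewrite mul1r.
rewrite Pf// [LHS]integral_mkcond; apply: eq_integral => x _.
by rewrite /= patchE indicE/=; case: ifPn => _; rewrite ?mulr1 ?mulr0.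
Qed.

(** By uniqueness of Lebesgue measure it is enough to compare the two measures on half-open
    intervals. *)
Lemma lebesgue_measure_scale (k : R) (A : set R) : (0 < k)%R -> measurable A ->
  k%:E * lebesgue_measure (( *%R k : R -> R) @^-1` A) = lebesgue_measure A.
Proof.
move=> k0 mA.
have mk : measurable_fun setT
    ( *%R k : measurableTypeR R -> measurableTypeR R).
  exact: mulrl_measurable.
pose nu := mscale (NngNum (ltW k0)) (pushforward lebesgue_measure
  ( *%R k : measurableTypeR R -> measurableTypeR R)).
rewrite -[LHS]/(nu mk A).
apply/esym/lebesgue_measure_unique => // _ [[a b]] _ <-.
have kab : ( *%R k : R -> R) @^-1` `]a, b] = `](a / k)%R, (b / k)%R]%classic.
  apply/seteqP; split => x /=; rewrite !in_itv/= ltr_pdivrMr// ler_pdivlMr//;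
    by rewrite (mulrC x).
rewrite -[RHS]/(k%:E * lebesgue_measure (( *%R k : R -> R) @^-1` `]a, b])) kab.
rewrite !lebesgue_measure_itv/= !lte_fin ltr_pM2r ?invr_gt0//.
case: ifPn => _; last by rewrite mule0.
by rewrite -!EFinB -EFinM; congr EFin; field; rewrite gt_eqF.
Qed.

Lemma has_density_scale d (T : measurableType d) (P : probability T R)
    (X : T -> R) (f : R -> R) (k : R) : (0 < k)%R ->
  measurable_fun setT X -> has_density P X f ->
  has_density P (fun w => k * X w)%R (fun x => f (x / k) / k)%R.
Proof.
move=> k0 mX Pf; have [mf [f0 _]] := Pf.
have mk : measurable_fun setT ( *%R k : R -> R) by exact: mulrl_measurable.
have mfk : measurable_fun setT (fun x : R => f (x / k) / k)%R.
  apply: measurable_funM => //; apply: measurableT_comp => //.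
  exact: mulrr_measurable.
split => //; split => [x|A mA]; first by rewrite divr_ge0// ltW.
have mA1 : measurable_fun setT (\1_A : R -> R) by exact: measurable_indic.
have mkA : measurable_fun setT (fun x : R => \1_A (k * x)%R : R).
  exact: measurableT_comp mk.
have mkX : measurable_fun setT (fun w => k * X w)%R by exact: measurableT_comp.
transitivity (\int[P]_w (\1_A (k * X w)%R)%:E).
  by rewrite (integral_indic_comp P mkX mA).
rewrite (ge0_expectation_density mX Pf (phi := fun x => \1_A (k * x)%R))//.
(* The weight [k] is the Jacobian of the dilation; apart from it the integrand is a function of
   [k * x]. *)
transitivity (\int[lebesgue_measure]_x
    (k * (f (k * (x : R) / k) / k * \1_A (k * (x : R))))%:E).
  apply: eq_integral => x _; congr EFin.
  by rewrite (mulrC k x) mulfK ?gt_eqF// mulrA mulrCA mulfV ?gt_eqF// mulr1.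
transitivity (\int[lebesgue_measure]_x
    (1 * (f ((x : R) / k) / k * \1_A (x : R)))%:E).
  apply: (@ge0_integral_weighted_comp _ (measurableTypeR R) _
    (measurableTypeR R) lebesgue_measure _ (measurableTypeR R) lebesgue_measure
    ( *%R k) id (fun=> k) (fun=> 1%R) (fun x => f (x / k) / k * \1_A x)%R) => //.
  - by move=> _; exact: ltW.
  - exact: measurable_funM.
  - by move=> x; rewrite mulr_ge0// divr_ge0// ltW.
  - move=> B mB.
    under eq_integral do rewrite EFinM.
    rewrite ge0_integralZl_EFin ?ltW//; last first.
      apply/measurable_EFinP; apply: (measurableT_comp _ mk).
      exact: measurable_indic.
    transitivity (lebesgue_measure B).
      rewrite -(lebesgue_measure_scale k0 mB); congr (_ * _).
      exact: integral_indic_comp.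
    under [RHS]eq_integral do rewrite mul1r.
    by rewrite [RHS]integral_indic// setIT.
rewrite [RHS]integral_mkcond; apply: eq_integral => x _.
by rewrite /= patchE indicE/= mul1r; case: ifPn => _; rewrite ?mulr1 ?mulr0.
Qed.

Lemma expectation_prod_independent d (T : measurableType d)
    (P : probability T R) n (X : 'I_n -> T -> R) (u : 'I_n -> R -> R)
    (e : 'I_n -> R) :
  (forall i, measurable_fun setT (X i)) -> mutually_independent P X ->
  (forall i, measurable_fun setT (u i)) -> (forall i x, (0 <= u i x)%R) ->
  (forall i, \int[P]_w (u i (X i w))%:E = (e i)%:E) ->
  \int[P]_w (\prod_i u i (X i w))%R%:E = (\prod_i e i)%R%:E.
Proof.
move=> mX indX mu u0 ue.
(* The factors of index at least k are indicators; they are replaced one at a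
   time by arbitrary nonnegative measurable functions. *)
suff main k : forall (u : 'I_n -> R -> R) (e : 'I_n -> R),
    (forall i, measurable_fun setT (u i)) -> (forall i x, (0 <= u i x)%R) ->
    (forall i, \int[P]_w (u i (X i w))%:E = (e i)%:E) ->
    (forall i : 'I_n, (k <= i)%N -> exists2 A, measurable A & u i = \1_A) ->
    \int[P]_w (\prod_i u i (X i w))%R%:E = (\prod_i e i)%R%:E.
  by apply: (main n) => // i; rewrite leqNgt ltn_ord.
elim: k {u e mu u0 ue} => [|k IH] u e mu u0 ue uA.
  have {}uA i : {A | measurable A & u i = \1_A}.
    by apply/cid2; apply: uA.
  pose A i := s2val (uA i).
  have mA i : measurable (A i) by rewrite /A; case: (uA i).
  have uE i : u i = \1_(A i) by rewrite /A; case: (uA i).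
  have eE i : P (X i @^-1` A i) = (e i)%:E.
    by rewrite -ue uE integral_indic_comp.
  have mB : measurable (\bigcap_i (X i @^-1` A i)).
    apply: fin_bigcap_measurable => // i _; rewrite -[X in measurable X]setTI.
    exact: mX.
  have := indX A mA; under [in X in _ = X -> _]eq_bigr do rewrite eE.
  rewrite -(big_morph EFin (@EFinM R) erefl) => <-; rewrite -[in RHS](setIT (\bigcap_i _)).
  rewrite -integral_indic//; apply: eq_integral => w _; congr EFin.
  rewrite indicE; case: (boolP (w \in _)) => [|/negP wB].
    by move=> /set_mem wA; apply: big1 => i _; rewrite uE indicE mem_set//; exact: wA.
  have [i wAi] : exists i, ~ A i (X i w).
    by apply/existsNP => wA; apply: wB; apply/mem_set => i _; exact: wA.
  by rewrite (bigD1 i)//= uE indicE memNset// mul0r.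
have [nk|kn] := leqP n k.
  by apply: IH => // i; move: (ltn_ord i) => /[swap] /(leq_trans nk); rewrite leqNgt => /negP.
pose j := Ordinal kn.
have e0 i : (0 <= e i)%R.
  by rewrite -lee_fin -ue; apply: integral_ge0 => w _; rewrite lee_fin.
have me : measurable_fun setT (fun w => \prod_(i < n | i != j) u i (X i w))%R.
  under eq_fun do rewrite -big_filter.
  by apply: measurable_prod => i _; exact: measurableT_comp.
transitivity (\int[P]_w ((\prod_(i < n | i != j) u i (X i w)) *
    u j (X j w))%R%:E).
  by apply: eq_integral => w _; rewrite (bigD1 j)//= mulrC.
transitivity (\int[P]_w ((\prod_(i < n | i != j) e i) * u j (X j w))%R%:E).
  apply: (@ge0_integral_weighted_comp _ _ _ _ _ _ _ P (X j) (X j)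
    (fun w => \prod_(i < n | i != j) u i (X i w))%R
    (fun=> \prod_(i < n | i != j) e i)%R (u j)) => //.
  - by move=> w; apply: prodr_ge0.
  - by move=> w; apply: prodr_ge0.
  move=> A mA.
  (* With [u j] replaced by an indicator, every factor of index at least [k] is an indicator, so
     [IH] applies to [v]; the remaining factors have played the part of the weight. *)
  pose v i := if i == j then \1_A else u i.
  pose f i := if i == j then fine (P (X j @^-1` A)) else e i.
  have PA : (fine (P (X j @^-1` A)))%:E = P (X j @^-1` A).
    by rewrite fineK// fin_num_measure// -[X in measurable X]setTI; exact: mX.
  transitivity (\int[P]_w (\prod_i v i (X i w))%R%:E).
    apply: eq_integral => w _; congr EFin.
    rewrite [RHS](bigD1 j)//= [RHS]mulrC /v eqxx.
    by congr (_ * _)%R; apply: eq_bigr => i /negbTE ->.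
  rewrite (IH _ f); last 4 first.
  - by move=> i; rewrite /v; case: ifP => // _; exact: measurable_indic.
  - by move=> i x; rewrite /v; case: ifP.
  - move=> i; rewrite /v /f; case: ifPn => // /eqP ->.
    by rewrite integral_indic_comp.
  - move=> i; rewrite leq_eqVlt => /predU1P[ki|ki].
      exists A => //; rewrite /v ifT//; apply/eqP/val_inj; exact/esym.
    rewrite /v ifF; first exact: uA.
    by apply/negP => /eqP ij; move: ki; rewrite ij ltnn.
  under [RHS]eq_integral do rewrite EFinM.
  rewrite ge0_integralZl_EFin//; last 2 first.
  - apply/measurable_EFinP; apply: measurableT_comp => //.
  - exact: prodr_ge0.
  have -> : \int[P]_w (\1_A (X j w))%:E = (fine (P (X j @^-1` A)))%:E.
    by rewrite PA; exact: integral_indic_comp.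
  rewrite -EFinM; congr EFin.
  rewrite [LHS](bigD1 j)//= [LHS]mulrC /f eqxx.
  by congr (_ * _)%R; apply: eq_bigr => i /negbTE ->.
under eq_integral do rewrite EFinM.
rewrite ge0_integralZl_EFin//; last 3 first.
- by move=> w _; rewrite lee_fin.
- by apply/measurable_EFinP; exact: measurableT_comp.
- exact: prodr_ge0.
by rewrite ue -EFinM [in RHS](bigD1 j)//= mulrC.
Qed.

End measure_tools.

(** * Convex functions of the square *)

Section convexity.
Context {R : realType}.
Implicit Types psi : R -> R.

(** The three-point inequality without division: it is linear in [psi], so it passes to nonnegative
    combinations and pointwise limits. *)
Definition convex_nonneg psi := forall s t u, 0 <= s -> s <= t -> t <= u ->
  (u - s) * psi t <= (u - t) * psi s + (t - s) * psi u.

(** The affine function is the chord through the points of the graph over [a] and [b]. Each bound is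
    the three-point inequality for [s], [a], [b] taken in increasing order. *)
Lemma convex_nonneg_chord psi (a b : R) : convex_nonneg psi -> 0 <= a -> a < b ->
  exists alpha beta,
    (forall s, a <= s -> s <= b -> psi s <= alpha + beta * s) /\
    (forall s, 0 <= s -> s <= a \/ b <= s -> alpha + beta * s <= psi s).
Proof.
move=> cpsi a0 ab; have ba0 : 0 < b - a by rewrite subr_gt0.
pose beta := (psi b - psi a) / (b - a).
have betaE s : (b - a) * (psi a - beta * a + beta * s) =
    (b - s) * psi a + (s - a) * psi b.
  by rewrite /beta; field; rewrite gt_eqF.
exists (psi a - beta * a), beta; split => [s as_ sb|s s0 [sa|bs]];
    rewrite -(ler_pM2l ba0) betaE.
- exact: cpsi.
- by have := cpsi s a b s0 sa (ltW ab); lra.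
- by have := cpsi a b s a0 (ltW ab) bs; lra.
Qed.

(** Weighting the support inequalities at [s] and [u] by [u - t] and [t - s] makes the slope terms
    cancel. *)
Lemma convex_nonneg_support psi :
  (forall t, 0 <= t -> exists k, forall s, 0 <= s ->
     psi t + k * (s - t) <= psi s) -> convex_nonneg psi.
Proof.
move=> H s t u s0 st tu; have t0 := le_trans s0 st.
have [k Hk] := H t t0.
have h1 : (u - t) * (psi t + k * (s - t)) <= (u - t) * psi s.
  by rewrite ler_wpM2l ?subr_ge0// Hk.
have h2 : (t - s) * (psi t + k * (u - t)) <= (t - s) * psi u.
  by rewrite ler_wpM2l ?subr_ge0// Hk// (le_trans t0).
by apply: le_trans (lerD h1 h2); rewrite le_eqVlt; apply/orP; left; apply/eqP; ring.
Qed.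

(** By induction: the right side for [k + 1] exceeds [t] times the right side for [k] by
    [(u - t) * (t - s) * (u ^+ k - s ^+ k)], which is nonnegative. *)
Lemma convex_nonneg_exprn (k : nat) : convex_nonneg (fun s => s ^+ k).
Proof.
move=> s t u s0 st tu; have t0 := le_trans s0 st; have u0 := le_trans t0 tu.
elim: k => [|k IH]; first by rewrite !expr0; lra.
have su : s ^+ k <= u ^+ k by rewrite lerXn2r ?nnegrE// (le_trans st).
have h1 := ler_wpM2l t0 IH.
have h2 : 0 <= (u - t) * (t - s) * (u ^+ k - s ^+ k).
  by rewrite !mulr_ge0// subr_ge0.
rewrite !exprS; move: h1 h2; set S := s ^+ k; set T := t ^+ k; set U := u ^+ k.
by move=> h1 h2; lra.
Qed.

Lemma convex_nonneg_scale psi c : 0 <= c -> convex_nonneg psi ->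
  convex_nonneg (fun s => c * psi s).
Proof.
move=> c0 cpsi s t u s0 st tu; have := ler_wpM2l c0 (cpsi s t u s0 st tu).
by lra.
Qed.

Lemma convex_nonneg_sum (f : nat -> R -> R) n :
  (forall k, convex_nonneg (f k)) ->
  convex_nonneg (fun s => \sum_(0 <= k < n) f k s).
Proof.
move=> cf s t u s0 st tu; rewrite !mulr_sumr -big_split/=.
by apply: ler_sum => k _; exact: cf.
Qed.

Lemma convex_nonneg_lim (f : nat -> R -> R) psi :
  (forall n, convex_nonneg (f n)) ->
  (forall s, 0 <= s -> f n s @[n --> \oo] --> psi s) -> convex_nonneg psi.
Proof.
move=> cf fpsi s t u s0 st tu; have t0 := le_trans s0 st.
have u0 := le_trans t0 tu.
have hl : (u - s) * f n t @[n --> \oo] --> (u - s) * psi t.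
  by apply: cvgMr; exact: fpsi.
have hr : (u - t) * f n s + (t - s) * f n u @[n --> \oo] -->
    (u - t) * psi s + (t - s) * psi u.
  by apply: cvgD; apply: cvgMr; exact: fpsi.
by apply: (ler_cvg_to hl hr); apply: nearW => n; exact: cf.
Qed.

(* The odd terms of the two exponential series cancel and the even ones are
   powers of s. *)
Lemma convex_nonneg_cosh_sqrt (xi : R) :
  convex_nonneg (fun s => expR (xi * Num.sqrt s) + expR (- (xi * Num.sqrt s))).
Proof.
apply: (@convex_nonneg_lim (fun n s => \sum_(0 <= k < n)
  ((if odd k then 0 else 2 * xi ^+ k / k`!%:R) * s ^+ (k./2)))).
  move=> n; apply: convex_nonneg_sum => k.
  apply: convex_nonneg_scale; last exact: convex_nonneg_exprn.
  case: ifPn => // ek; rewrite mulr_ge0// mulr_ge0//.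
  by rewrite exprn_even_ge0.
move=> s s0; set a := xi * Num.sqrt s.
rewrite (_ : (fun n => _) = (fun n => series (exp_coeff a) n +
    series (exp_coeff (- a)) n)).
  by apply: cvgD; exact: is_cvg_series_exp_coeff.
apply/funext => n; rewrite /series/= -big_split/=; apply: eq_bigr => k _.
rewrite /exp_coeff /= /a exprNn exprMn -signr_odd; case: ifPn => ok /=.
  by rewrite expr1 mul0r; lra.
have -> : Num.sqrt s ^+ k = s ^+ k./2.
  by rewrite -[in LHS](odd_double_half k) (negbTE ok) add0n -mul2n exprM sqr_sqrtr.
by rewrite expr0; lra.
Qed.

End convexity.

(** * The closed form of the Cramer transform of the double exponential law *)

Section laplace_cramer.
Context {R : realType}.

(* The closed form of e^(- Lambda_Y^* (y)) for Y standard double exponential. *)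
Definition laplace_cramer (y : R) : R :=
  (1 + Num.sqrt (1 + y ^+ 2)) / 2 * expR (1 - Num.sqrt (1 + y ^+ 2)).

Lemma sqrt1D_ge1 (s : R) : 0 <= s -> 1 <= Num.sqrt (1 + s).
Proof. by move=> s0; rewrite -[leLHS]sqrtr1 ler_sqrt; lra. Qed.

Lemma laplace_cramer_ge0 y : 0 <= laplace_cramer y.
Proof. by rewrite mulr_ge0 ?expR_ge0// divr_ge0// addr_ge0// sqrtr_ge0. Qed.

Lemma laplace_cramer_le1 y : laplace_cramer y <= 1.
Proof.
have u1 := sqrt1D_ge1 (sqr_ge0 y).
rewrite /laplace_cramer; move: u1; set u := Num.sqrt _ => u1.
have h : (1 + u) / 2 <= expR (u - 1).
  by have := expR_ge1Dx (u - 1); lra.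
rewrite -opprB expRN ler_pdivrMr ?expR_gt0// mul1r//.
Qed.

Lemma convex_nonneg_laplace_cramer : convex_nonneg (fun s : R =>
  (1 + Num.sqrt (1 + s)) / 2 * expR (1 - Num.sqrt (1 + s))).
Proof.
apply: convex_nonneg_support => t t0.
pose v := Num.sqrt (1 + t).
(* The slope is the derivative at [t]: with u = sqrt (1 + s), (1 + u) / 2 * e^(1 - u) has
   u-derivative - u / 2 * e^(1 - u), and du/ds = 1 / (2 u). *)
exists (- (4^-1 * expR (1 - v))) => s s0.
have u1 := sqrt1D_ge1 s0; have v1 := sqrt1D_ge1 t0; rewrite -/v in v1 *.
have u2 : Num.sqrt (1 + s) ^+ 2 = 1 + s by rewrite sqr_sqrtr; lra.
have v2 : v ^+ 2 = 1 + t by rewrite sqr_sqrtr; lra.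
move: u1 u2; set u := Num.sqrt (1 + s) => u1 u2.
have -> : s - t = u ^+ 2 - v ^+ 2 by rewrite u2 v2; lra.
have -> : 1 - u = (v - u) + (1 - v) by lra.
rewrite (expRD (v - u) (1 - v)).
have [d ud] : exists d, u = v + d by exists (u - v); lra.
have -> : v - u = - d by lra.
(* This is the support inequality divided by [4^-1 * expR (1 - v)]. For [d <= 2] it follows from
   e^(- d) >= (1 - d / 2) ^ 2 and [1 <= u]; for [d > 2], from e^(- d) >= 0 and [1 + d <= u], a
   consequence of [1 <= v]. *)
have key : d ^+ 2 <= 2 * (1 + u) * (expR (- d) - 1 + d).
  have [d2|d2] := leP d 2.
    have h1 : 0 <= 1 - d / 2 by lra.
    have h2 : 1 - d / 2 <= expR (- d / 2) by have := expR_ge1Dx (- d / 2); lra.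
    have h3 : (1 - d / 2) ^+ 2 <= expR (- d).
      rewrite (_ : - d = - d / 2 + - d / 2); last by lra.
      by rewrite expRD expr2 ler_pM.
    have h4 : 0 <= (1 + u - 2) * (d ^+ 2) by rewrite mulr_ge0 ?sqr_ge0//; lra.
    have h5 : 2 * (1 + u) * (d ^+ 2 / 4) <= 2 * (1 + u) * (expR (- d) - 1 + d).
      by rewrite ler_wpM2l//; lra.
    lra.
  have h : 0 <= expR (- d) := expR_ge0 _.
  have ud1 : 1 + d <= u by lra.
  apply: (@le_trans _ _ (2 * (2 + d) * (d - 1))); first nra.
  apply: ler_pM; lra.
have e0 : 0 <= 4^-1 * expR (1 - v) by rewrite mulr_ge0 ?expR_ge0.
have := ler_wpM2l e0 key.
by rewrite ud; lra.
Qed.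

(** With a = (1 - xi ^ 2) * (1 + u) / 2, one has a <= e^(a - 1), and the required bound on the
    exponent a - 1 amounts to ((1 + u) * xi - y) ^ 2 >= 0. *)
Lemma laplace_cramer_le (y xi : R) : `|xi| < 1 ->
  laplace_cramer y <= expR (- (y * xi)) * (1 - xi ^+ 2)^-1.
Proof.
move=> xi1; have xi2 : 0 < 1 - xi ^+ 2.
  by rewrite subr_gt0 -[xi ^+ 2]real_normK ?num_real// exprn_ilt1.
rewrite ler_pdivlMr//.
have u1 := sqrt1D_ge1 (sqr_ge0 y).
have u2 : Num.sqrt (1 + y ^+ 2) ^+ 2 = 1 + y ^+ 2.
  by rewrite sqr_sqrtr// addr_ge0// sqr_ge0.
rewrite /laplace_cramer; move: u1 u2; set u := Num.sqrt _ => u1 u2.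
have e1 : (1 - xi ^+ 2) * (1 + u) / 2 <=
    expR ((1 - xi ^+ 2) * (1 + u) / 2 - 1).
  by have := expR_ge1Dx ((1 - xi ^+ 2) * (1 + u) / 2 - 1); lra.
have e2 : (1 - xi ^+ 2) * (1 + u) / 2 - 1 <= u - 1 - y * xi.
  have h : 0 <= (1 + u) * ((1 + u) * xi ^+ 2 - 2 * y * xi + u - 1).
    rewrite (_ : _ * _ = ((1 + u) * xi - y) ^+ 2) ?sqr_ge0//.
    have y2 : y ^+ 2 = u ^+ 2 - 1 by lra.
    by rewrite sqrrB y2; ring.
  by rewrite pmulr_rge0 in h; lra.
have e3 : (1 - xi ^+ 2) * (1 + u) / 2 <= expR (u - 1 - y * xi).
  by rewrite (le_trans e1)// ler_expR.
rewrite (_ : - (y * xi) = (u - 1 - y * xi) + (1 - u)); last by lra.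
rewrite (expRD (u - 1 - y * xi)) mulrAC; apply: ler_wpM2r; last by lra.
exact: expR_ge0.
Qed.

(** Equality case of [laplace_cramer_le]: the choice y / (1 + u) makes the square vanish and gives a
    = 1. Hence [laplace_cramer y] is the minimum of e^(- y xi) / (1 - xi ^ 2) over |xi| < 1. *)
Lemma laplace_cramer_exists (y : R) : exists2 s, `|s| < 1 &
  laplace_cramer y = expR (- (y * s)) * (1 - s ^+ 2)^-1.
Proof.
have u1 := sqrt1D_ge1 (sqr_ge0 y).
have u2 : Num.sqrt (1 + y ^+ 2) ^+ 2 = 1 + y ^+ 2.
  by rewrite sqr_sqrtr// addr_ge0// sqr_ge0.
rewrite /laplace_cramer; move: u1 u2; set u := Num.sqrt _ => u1 u2.
have y2 : y ^+ 2 = u ^+ 2 - 1 by rewrite u2; lra.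
have ud : 1 + u != 0 by rewrite gt_eqF//; lra.
have ss : (y / (1 + u)) ^+ 2 = (u - 1) / (1 + u).
  by rewrite expr_div_n y2; field.
exists (y / (1 + u)).
  rewrite -(@ltr_pXn2r _ 2)// ?nnegrE// real_normK ?num_real// ss expr1n.
  by rewrite ltr_pdivrMr; lra.
rewrite ss mulrC; congr (expR _ * _).
  by rewrite mulrA -expr2 y2; field.
by field; rewrite ud/=; lra.
Qed.

End laplace_cramer.

(** * Log-concave functions against the Laplace density *)

Section log_concave.
Context {R : realType}.
Variable f : R -> R.
Hypotheses (f0 : forall x, 0 <= f x) (ef : even_fun f) (lf : log_concave f).

Lemma even_fun_norm x : f `|x| = f x.
Proof. by have [x0|x0] := leP 0 x; rewrite ?(ger0_norm x0) ?(ltr0_norm x0)// ef. Qed.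

(** The origin is the midpoint of [x] and [- x], where [f] takes equal values. *)
Lemma log_concave_even_max x : f x <= f 0.
Proof.
have := lf x (- x) (t := 2^-1); rewrite ef -powRD; last first.
  by apply/implyP; rewrite gt_eqF//; lra.
have -> : 2^-1 + (1 - 2^-1) = 1 :> R by lra.
rewrite powRr1//.
have -> : 2^-1 * x + (1 - 2^-1) * - x = 0 by field.
by apply; lra.
Qed.

(** Exponentials of affine functions turn the log-concavity inequality into an equality, so
    domination at two points extends to the points between them. *)
Lemma log_concave_ge_exp (c k x y z : R) : x < y -> y < z ->
  expR (c + k * x) <= f x -> expR (c + k * z) <= f z -> expR (c + k * y) <= f y.
Proof.
move=> xy yz fx fz; pose t := (z - y) / (z - x).
have zx : 0 < z - x by lra.
have t01 : 0 < t < 1.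
  by rewrite /t; apply/andP; split;
    [rewrite divr_gt0// | rewrite ltr_pdivrMr//]; lra.
have yE : y = t * x + (1 - t) * z by rewrite /t; field; rewrite gt_eqF.
have := lf x z t01; rewrite -yE; apply: le_trans.
have -> : expR (c + k * y) =
    (expR (c + k * x)) `^ t * (expR (c + k * z)) `^ (1 - t).
  by rewrite -!expRM -expRD; congr expR; rewrite [in LHS]yE; ring.
have /andP[t0 t1] := t01.
by rewrite ler_pM ?powR_ge0// ge0_ler_powR ?nnegrE ?expR_ge0//; lra.
Qed.

Lemma log_concave_decay c : 0 < c -> f c < f 0 ->
  exists C k, 0 < k /\ forall x, f x <= C * expR (- k * `|x|).
Proof.
move=> c0 fc; have F0 : 0 < f 0 by exact: le_lt_trans fc.
(* The average stays strictly above [f c] and is positive even if [f c = 0], so its logarithm is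
   meaningful. The rate [k] is that of the exponential equal to [f 0] at 0 and to this average at
   [c]. *)
have [fc0 fce] : 0 < (f 0 + f c) / 2 /\ f c < (f 0 + f c) / 2.
  by have := f0 c; lra.
pose k := (ln (f 0) - ln ((f 0 + f c) / 2)) / c.
have k0 : 0 < k by rewrite divr_gt0// subr_gt0 ltr_ln ?posrE//; lra.
have fcE : expR (ln (f 0) + - k * c) = (f 0 + f c) / 2.
  rewrite (_ : _ + _ = ln ((f 0 + f c) / 2)) ?lnK ?posrE//.
  by rewrite /k; field; rewrite gt_eqF.
(* The factor [expR (k * c)] makes the bound at least [f 0] on [0, c], where only the maximality of
   [f 0] is used. *)
exists (f 0 * expR (k * c)), k; split => // x.
rewrite -even_fun_norm; set z := `|x|; have z0 : 0 <= z by exact: normr_ge0.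
rewrite -mulrA -expRD.
have [zc|cz] := leP z c.
  apply: (le_trans (log_concave_even_max z)); apply: ler_peMr; first exact: ltW.
  rewrite -[leLHS]expR0 ler_expR; have : 0 <= k * (c - z) by rewrite mulr_ge0//; lra.
  by lra.
apply: (@le_trans _ _ (f 0 * expR (- k * z))); last first.
  apply: ler_wpM2l; first exact: ltW.
  rewrite ler_expR; have : 0 <= k * c by rewrite mulr_ge0//; lra.
  by lra.
(* If [f] exceeded the exponential at [z], it would dominate it at 0 and [z], hence at [c], where
   the exponential is larger than [f c]. *)
rewrite leNgt; apply/negP => fz.
have /(_ (ln (f 0)) (- k)) := @log_concave_ge_exp _ _ 0 c z c0 cz.
rewrite fcE mulr0 addr0 lnK ?posrE// lexx expRD lnK ?posrE// (ltW fz).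
by move=> /(_ isT isT); lra.
Qed.

End log_concave.

(** * Crossings of a log-concave function with the Laplace density *)

Section laplace_density.
Context {R : realType}.

Definition laplace_pdf (x : R) : R := 2^-1 * expR (- `|x|).

Lemma laplace_pdf_gt0 x : 0 < laplace_pdf x.
Proof. by apply: mulr_gt0; [lra|exact: expR_gt0]. Qed.

Lemma laplace_pdfE x : 0 <= x -> laplace_pdf x = expR (- ln 2 + -1 * x).
Proof.
move=> x0; rewrite expRD expRN lnK ?posrE//.
by rewrite /laplace_pdf ger0_norm// mulN1r.
Qed.

Lemma laplace_pdf_norm x : laplace_pdf `|x| = laplace_pdf x.
Proof. by rewrite /laplace_pdf normr_id. Qed.

Lemma log_concave_ge_laplace (f : R -> R) x y z : (forall x, 0 <= f x) ->
  log_concave f -> 0 <= x -> x < y -> y < z ->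
  laplace_pdf x <= f x -> laplace_pdf z <= f z -> laplace_pdf y <= f y.
Proof.
move=> f0 lf x0 xy yz; rewrite !laplace_pdfE; try lra.
exact: log_concave_ge_exp.
Qed.

(* The set of all |x| at which f dominates the Laplace density is an interval:
   it has at most one point, is bounded with endpoints a < b, or is unbounded
   with infimum a. Only the second case survives equality of the moments of
   order 0 and 2, unless the two densities agree almost everywhere. *)
Lemma log_concave_laplace_cases (f : R -> R) : (forall x, 0 <= f x) ->
  even_fun f -> log_concave f ->
  [\/ exists p, forall x, x != p -> x != - p -> f x <= laplace_pdf x,
      exists a b, [/\ 0 <= a, a < b,
        (forall x, laplace_pdf x <= f x -> a <= `|x| <= b) &
        (forall x, f x < laplace_pdf x -> `|x| <= a \/ b <= `|x|)] |
      exists2 a, 0 <= a & forall x, 0 <= (x ^+ 2 - a ^+ 2) * (f x - laplace_pdf x)].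
Proof.
move=> f0 ef lf; pose I : set R := [set x | 0 <= x /\ laplace_pdf x <= f x].
have normI x : laplace_pdf x <= f x -> I `|x|.
  by move=> fx; split => //; rewrite laplace_pdf_norm even_fun_norm.
have notI x : f x < laplace_pdf x -> ~ I `|x|.
  by move=> fx [_]; rewrite laplace_pdf_norm even_fun_norm// leNgt fx.
have convI x y z : I x -> I z -> x < y -> y < z -> I y.
  move=> [x0 fx] [z0 fz] xy yz; split; first by lra.
  exact: (@log_concave_ge_laplace f x y z).
have [[x0 [y0 [Ix0 Iy0 xy0]]]|noI] := pselect (exists x y, [/\ I x, I y & x < y]);
    last first.
  constructor 1.
  have [[p Ip]|I0] := pselect (exists p, I p).
    exists p => x xp xNp; rewrite leNgt; apply/negP => /ltW/normI Ix.
    have xnp : `|x| != p.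
      apply/negP => /eqP; have [x0|x0] := leP 0 x; rewrite ?(ger0_norm x0) ?(ltr0_norm x0).
        by move=> /eqP; rewrite (negbTE xp).
      by move=> xE; move: xNp; rewrite -xE opprK eqxx.
    by move: xnp; rewrite neq_lt => /orP[h|h]; apply: noI; [exists `|x|, p|exists p, `|x|].
  exists 0 => x _ _; rewrite leNgt; apply/negP => /ltW/normI Ix.
  by apply: I0; exists `|x|.
have lbI : has_lbound I by exists 0 => x [].
have neI : I !=set0 by exists x0.
have a0 : 0 <= inf I by apply: lb_le_inf => // x [].
have ltI z : inf I < z -> exists2 x, I x & x < z.
  by move=> az; have [x Ix xz] := inf_lt neI az; exists x.
have [ubI|nubI] := pselect (has_ubound I).
  constructor 2; exists (inf I), (sup I); split => //.
  - apply: (@le_lt_trans _ _ x0); first exact: ge_inf.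
    by apply: (lt_le_trans xy0); exact: ub_le_sup.
  - by move=> x /normI Ix; rewrite ge_inf//= ub_le_sup.
  - move=> x /notI Ix; have [|ax] := leP `|x| (inf I); first by left.
    have [|xb] := leP (sup I) `|x|; first by right.
    exfalso; apply: Ix.
    have [x1 Ix1 x1x] := ltI _ ax; have [y1 Iy1 xy1] := sup_gt neI xb.
    exact: convI Ix1 Iy1 x1x xy1.
constructor 3; exists (inf I) => // x.
have x2 : x ^+ 2 = `|x| ^+ 2 by rewrite real_normK// num_real.
rewrite x2; have [fx|/notI Ix] := leP (laplace_pdf x) (f x).
  rewrite mulr_ge0 ?subr_ge0// lerXn2r ?nnegrE//.
  by apply: ge_inf => //; exact: normI.
have fx : f x <= laplace_pdf x.
  rewrite leNgt; apply/negP => /ltW/normI; exact: Ix.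
rewrite mulr_le0 ?subr_le0// lerXn2r ?nnegrE//.
rewrite leNgt; apply/negP => /ltI[x1 Ix1 x1x]; apply: Ix.
have [y1 Iy1 xy1] : exists2 y, I y & `|x| < y.
  apply: contra_notP nubI => H; exists `|x| => y Iy; rewrite leNgt.
  by apply/negP => xy; apply: H; exists y.
exact: convI Ix1 Iy1 x1x xy1.
Qed.

End laplace_density.

(** * Laplace integrals *)

Section lebesgue_comparison.
Context {R : realType}.
Local Open Scope ereal_scope.
Notation mu := (@lebesgue_measure R).

Lemma measurable_norm : measurable_fun setT (fun x : R => `|x|%R).
Proof. exact: measurableT_comp. Qed.

Lemma measurable_expR_comp (h : R -> R) : measurable_fun setT h ->
  measurable_fun setT (fun x => expR (h x)).
Proof. by move=> mh; exact: measurableT_comp. Qed.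

Lemma measurable_laplace_pdf : measurable_fun setT (@laplace_pdf R).
Proof.
apply: measurable_funM => //; apply: measurable_expR_comp.
by apply: measurableT_comp => //; exact: measurable_norm.
Qed.

Lemma measurable_sqr : measurable_fun setT (fun x : R => x ^+ 2)%R.
Proof. exact: measurable_funX. Qed.

Lemma ge0_integral_opp (f : R -> R) : measurable_fun setT f ->
  (forall x, (0 <= f x)%R) ->
  \int[mu]_x (f (- (x : R))%R)%:E = \int[mu]_x (f x)%:E.
Proof.
move=> mf f0.
transitivity (\int[mu]_x (1 * f (- (x : R)))%R%:E).
  by apply: eq_integral => x _; rewrite mul1r.
transitivity (\int[mu]_x (1 * f x)%R%:E); last first.
  by apply: eq_integral => x _; rewrite mul1r.
apply: (@ge0_integral_weighted_comp _ _ (measurableTypeR R) _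
    (measurableTypeR R) mu _ (measurableTypeR R) mu
    -%R id (fun=> 1%R) (fun=> 1%R) f) => //.
move=> A mA; transitivity (mu A).
  rewrite -lebesgue_measureN// /pushforward.
  under eq_integral do rewrite mul1r.
  by apply: integral_indic_comp.
under eq_integral do rewrite mul1r.
by rewrite integral_indic// setIT.
Qed.

Lemma integral_expR_pos (r : R) : (0 < r)%R ->
  \int[mu]_(x in `[0%R, +oo[) (expR (- r * x))%:E = r^-1%:E.
Proof.
move=> r0; have := integral_exponential_pdf r0.
rewrite (_ : (fun x => (exponential_pdf r x)%:E) =
    (fun x => r%:E * (expR (- r * x))%:E) \_ `[0%R, +oo[); last first.
  apply/funext => x; rewrite /exponential_pdf !patchE.
  by case: ifPn => //; rewrite EFinM.
rewrite -integral_mkcond ge0_integralZl_EFin ?ltW//; last first.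
  apply/measurable_EFinP; apply: measurable_funTS; apply: measurable_expR_comp.
  exact: mulrl_measurable.
move=> H; rewrite -[LHS]mul1e (_ : 1 = r^-1%:E * r%:E); last first.
  by rewrite -EFinM mulVf// gt_eqF.
by rewrite -muleA H mule1.
Qed.

Lemma ge0_integral_split0 (f : R -> R) : measurable_fun setT f ->
  (forall x, (0 <= f x)%R) ->
  \int[mu]_x (f x)%:E = \int[mu]_(x in `[0%R, +oo[) (f x)%:E +
    \int[mu]_(x in `[0%R, +oo[) (f (- (x : R))%R)%:E.
Proof.
move=> mf f0.
have mfN : measurable_fun setT (fun x : R => f (- x)%R).
  exact: measurableT_comp.
rewrite (@ge0_integration_by_substitution0 R (fun x => (f (- x)%R)%:E)); last 2 first.
- exact/measurable_EFinP.
- by move=> x; rewrite lee_fin.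
under [X in _ = _ + X]eq_integral do rewrite opprK.
rewrite -(@integral_itv_bndo_bndc _ _ 0%R (fun x => (f x)%:E)); last first.
  by apply/measurable_EFinP; exact: measurable_funTS.
rewrite -[in LHS](setUv `[0%R, +oo[%classic) ge0_integral_setU//=; last 4 first.
- exact: measurableC.
- by rewrite setUv; exact/measurable_EFinP.
- by move=> x _; rewrite lee_fin.
- exact/disj_setPCl.
by rewrite setCitvr.
Qed.

Lemma integral_expR_linear_norm (r xi : R) : (`|xi| < r)%R ->
  \int[mu]_x (expR (xi * x - r * `|x|))%:E =
  ((r - xi)^-1 + (r + xi)^-1)%:E.
Proof.
rewrite ltr_norml => /andP[xi1 xi2].
rewrite (@ge0_integral_split0 (fun x => expR (xi * x - r * `|x|))); last 2 first.
- apply: measurable_expR_comp; apply: measurable_funB.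
    exact: mulrl_measurable.
  by apply: measurable_funM => //; exact: measurable_norm.
- by move=> x; exact: expR_ge0.
rewrite EFinD; congr (_ + _).
  rewrite -integral_expR_pos ?subr_gt0//; apply: eq_integral => x.
  rewrite inE/= in_itv/= andbT => x0; rewrite ger0_norm//.
  by congr (expR _)%:E; ring.
rewrite -integral_expR_pos; last by lra.
apply: eq_integral => x; rewrite inE/= in_itv/= andbT => x0.
by rewrite normrN ger0_norm//; congr (expR _)%:E; ring.
Qed.

(** On the half-line where [xi * x] is nonnegative the integrand is at least 1. *)
Lemma integral_expR_linear_norm_pinfty (xi : R) : (1 <= `|xi|)%R ->
  \int[mu]_x (expR (xi * x - `|x|))%:E = +oo.
Proof.
move=> xi1.
have mh (c : R) : measurable_fun setT (fun x : R => expR (c * x - `|x|)).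
  apply: measurable_expR_comp; apply: measurable_funB.
    exact: mulrl_measurable.
  exact: measurable_norm.
have oo (c : R) : (1 <= c)%R ->
    \int[mu]_(x in `[0%R, +oo[) (expR (c * x - `|x|))%:E = +oo.
  move=> c1; apply/eqP; rewrite -leye_eq.
  apply: (@le_trans _ _ (\int[mu]_(x in `[0%R, +oo[) (cst 1 x))).
    have muoo : mu `[0%R, +oo[%classic = +oo.
      by rewrite lebesgue_measure_itv/= ltry.
    rewrite (@integral_cst _ _ _ (@lebesgue_measure R)) ?mul1e//.
    by rewrite [leRHS]muoo.
  apply: ge0_le_integral => //.
    by apply/measurable_EFinP; apply: measurable_funTS; exact: mh.
  move=> x; rewrite /= in_itv/= andbT => x0.
  rewrite lee_fin -[leLHS]expR0 ler_expR ger0_norm//.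
  by rewrite -{2}(mul1r x) -mulrBl mulr_ge0// subr_ge0.
rewrite (@ge0_integral_split0 (fun x => expR (xi * x - `|x|))); last 2 first.
- exact: mh.
- by move=> x; exact: expR_ge0.
have [xi0|xi0] := leP 0%R xi.
  rewrite oo ?addye//; last by rewrite -(ger0_norm xi0).
  rewrite gt_eqF// (lt_le_trans ltNy0)//.
  by apply: integral_ge0 => x _; rewrite lee_fin expR_ge0.
rewrite [X in _ + X](_ : _ = +oo); last first.
  rewrite -(oo (- xi)%R); last by rewrite -(ltr0_norm xi0).
  by apply: eq_integral => x _; rewrite normrN mulrN mulNr.
rewrite addey// gt_eqF// (lt_le_trans ltNy0)//.
by apply: integral_ge0 => x _; rewrite lee_fin expR_ge0.
Qed.

Lemma second_moment_decay (f : R -> R) (C k : R) : (0 < k)%R ->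
  measurable_fun setT f -> (forall x, (0 <= f x)%R) ->
  (forall x, (f x <= C * expR (- k * `|x|))%R) ->
  mu.-integrable setT (fun x : R => (x ^+ 2 * f x)%:E).
Proof.
move=> k0 mf f0 fC.
have C0 : (0 <= C)%R.
  by have := le_trans (f0 0%R) (fC 0%R); rewrite pmulr_lge0 ?expR_gt0.
(* Half of the decay rate pays for [x ^+ 2]: the constant 8 / k ^ 2 comes from y ^ 2 / 2 <= e^y at y
   = k |x| / 2. The term [0 * x] gives the majorant the shape of [integral_expR_linear_norm]. *)
apply: (@le_integrable _ (measurableTypeR R) R mu setT measurableT _
    (fun x : measurableTypeR R => (8 / k ^+ 2 * C * expR (0 * x - (k / 2) * `|x|))%:E)).
- by apply/measurable_EFinP; apply: measurable_funM => //; exact: measurable_sqr.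
- move=> x _; rewrite !abse_EFin lee_fin ger0_norm; last first.
    by rewrite mulr_ge0// sqr_ge0.
  apply: le_trans (ler_norm _).
  apply: le_trans (ler_wpM2l (sqr_ge0 x) (fC x)) _.
  have y0 : (0 <= k / 2 * `|x|)%R by rewrite mulr_ge0//; lra.
  have e2 : (x ^+ 2 <= 8 / k ^+ 2 * expR (k / 2 * `|x|))%R.
    have := expR_ge1Dxn 1 y0; rewrite exprMn real_normK ?num_real//.
    rewrite (_ : 1.+1`! = 2)%N//.
    set E := expR _ => h; rewrite mulrAC ler_pdivlMr ?exprn_gt0//.
    by move: h; rewrite expr_div_n; lra.
  have -> : (8 / k ^+ 2 * C * expR (0 * x - (k / 2) * `|x|) =
      8 / k ^+ 2 * expR (k / 2 * `|x|) * (C * expR (- k * `|x|)))%R.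
    rewrite (_ : 0 * x - k / 2 * `|x| = k / 2 * `|x| + - k * `|x|)%R; last by lra.
    by rewrite expRD; field; rewrite gt_eqF.
  by rewrite ler_wpM2r// mulr_ge0// expR_ge0.
- under eq_fun do rewrite EFinM.
  apply: integrableZl => //; apply/integrableP; split.
    apply/measurable_EFinP; apply: measurable_expR_comp.
    apply: measurable_funB; first exact: mulrl_measurable.
    by apply: measurable_funM => //; exact: measurable_norm.
  under eq_integral do rewrite abse_EFin ger0_norm ?expR_ge0//.
  by rewrite integral_expR_linear_norm ?ltry// normr0; lra.
Qed.

End lebesgue_comparison.

(** * Comparison of moments *)

Section comparison.
Context {R : realType}.
Local Open Scope ereal_scope.
Notation mu := (@lebesgue_measure R).
Implicit Types f g phi : R -> R.

Lemma ae_neq (p : R) : {ae mu, forall x, x != p}.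
Proof.
exists [set p]; split => //; first exact: lebesgue_measure_set1.
by move=> x /= /negP/negPn/eqP.
Qed.

Lemma ae_lebesgueS2 (A B C : set R) : {ae mu, forall x, A x} ->
  {ae mu, forall x, B x} -> (forall x, A x -> B x -> C x) ->
  {ae mu, forall x, C x}.
Proof.
move=> aeA aeB ABC.
exact: (@filterS2 _ _ (ae_filter_ringOfSetsType mu) _ _ _ ABC aeA aeB).
Qed.

Lemma integral_laplace_pdf : \int[mu]_x (laplace_pdf x)%:E = 1.
Proof.
rewrite /laplace_pdf; under eq_integral do rewrite EFinM.
rewrite ge0_integralZl_EFin//; last first.
  apply/measurable_EFinP; apply: measurable_expR_comp.
  by apply: measurableT_comp => //; exact: measurable_norm.
rewrite (eq_integral (fun x : measurableTypeR R => (expR (0 * x - 1 * `|x|))%:E)); last first.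
  by move=> x _; rewrite mul0r mul1r sub0r.
rewrite integral_expR_linear_norm ?normr0//.
by rewrite -EFinM; congr EFin; field.
Qed.

Lemma ge0_integrable_fin (f : R -> R) : measurable_fun setT f ->
  (forall x, (0 <= f x)%R) -> \int[mu]_x (f x)%:E < +oo ->
  mu.-integrable setT (fun x => (f x)%:E).
Proof.
move=> mf f0 foo; apply/integrableP; split; first exact/measurable_EFinP.
by under eq_integral do rewrite abse_EFin ger0_norm//.
Qed.

Lemma integrable_laplace_pdf : mu.-integrable setT (fun x => (laplace_pdf x)%:E).
Proof.
apply: ge0_integrable_fin; first exact: measurable_laplace_pdf.
  by move=> x; rewrite ltW// laplace_pdf_gt0.
by rewrite integral_laplace_pdf ltry.
Qed.

Lemma integrable_laplace_second_moment :
  mu.-integrable setT (fun x : R => (x ^+ 2 * laplace_pdf x)%:E).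
Proof.
apply: (@second_moment_decay _ _ 2^-1 1) => //.
- exact: measurable_laplace_pdf.
- by move=> x; rewrite ltW// laplace_pdf_gt0.
- by move=> x; rewrite mulN1r.
Qed.

(** A zero second moment would force [f] to vanish almost everywhere off the origin, against total
    mass 1. This allows division by the moment when rescaling. *)
Lemma second_moment_gt0 f : measurable_fun setT f -> (forall x, (0 <= f x)%R) ->
  \int[mu]_x (f x)%:E = 1 -> 0 < \int[mu]_x ((x : R) ^+ 2 * f x)%:E.
Proof.
move=> mf f0 f1.
have mxf : measurable_fun setT (fun x : R => x ^+ 2 * f x)%R.
  by apply: measurable_funM => //; exact: measurable_sqr.
rewrite lt0e integral_ge0 ?andbT; last first.
  by move=> x _; rewrite lee_fin mulr_ge0// sqr_ge0.
apply/eqP => xf0.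
have : ae_eq mu setT (fun x => ((x : R) ^+ 2 * f x)%:E) (cst 0).
  apply/ae_eq_integral_abs => //; first exact/measurable_EFinP.
  rewrite -[RHS]xf0; apply: eq_integral => x _.
  by rewrite abse_EFin ger0_norm// mulr_ge0// sqr_ge0.
move=> xf0ae; have : ae_eq mu setT (fun x => (f x)%:E) (cst 0).
  apply: ae_lebesgueS2 (ae_neq 0) xf0ae _ => x x0 /(_ Logic.I) [] /eqP.
  by rewrite mulf_eq0 sqrf_eq0 (negbTE x0) => /eqP ->.
move=> fae; have : \int[mu]_x (f x)%:E = \int[mu]_x (cst 0 x).
  by apply: ae_eq_integral => //; exact/measurable_EFinP.
by rewrite f1 integral0 => /eqP; rewrite onee_eq0.
Qed.

(** Either [f] drops below [f 0] somewhere on the positive half-line, and then decays exponentially,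
    or it is constant, and its integral is 0 or infinite. *)
Lemma log_concave_second_moment f : measurable_fun setT f ->
  (forall x, (0 <= f x)%R) -> even_fun f -> log_concave f ->
  \int[mu]_x (f x)%:E = 1 ->
  mu.-integrable setT (fun x : R => (x ^+ 2 * f x)%:E).
Proof.
move=> mf f0 ef lf f1.
have [[c c0 fc]|H] := pselect (exists2 c, (0 < c)%R & (f c < f 0)%R).
  have [C [k [k0 fC]]] := log_concave_decay f0 ef lf c0 fc.
  exact: (second_moment_decay k0).
exfalso; have fE x : f x = f 0%R.
  apply/eqP; rewrite eq_le log_concave_even_max//= leNgt; apply/negP => fx.
  have x0 : x != 0%R by apply/eqP => x0; move: fx; rewrite x0 ltxx.
  by apply: H; exists `|x|%R; rewrite ?normr_gt0// even_fun_norm.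
move: f1; under eq_integral do rewrite fE.
rewrite (@integral_cst _ _ _ mu _ _ (f 0%R)%:E)//.
have muT : mu setT = +oo by rewrite -set_itvNyy lebesgue_measure_itv.
rewrite [X in _ * X]muT.
have := f0 0%R; rewrite le_eqVlt => /predU1P[<-|fgt].
  by rewrite mul0e => /eqP; rewrite eq_sym onee_eq0.
by rewrite gt0_muley ?lte_fin.
Qed.

Lemma integral_sub_eq0 (u v : R -> \bar R) :
  mu.-integrable setT u -> mu.-integrable setT v ->
  \int[mu]_x u x = \int[mu]_x v x ->
  mu.-integrable setT (u \- v) /\ \int[mu]_x (u x - v x) = 0.
Proof.
move=> iu iv uv; split; first exact: integrableB.
by rewrite integralB// uv subee//; exact: integrable_fin_num.
Qed.

(** The correction [(al + be * x ^+ 2) * (f x - g x)] integrates to 0 by equality of moments. The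
    pointwise bound isolates [f x * phi x] because its integrability is not known in advance, unlike
    that of [g x * phi x]. *)
Lemma ge0_integral_le_of_moments f g phi (al be : R) :
  measurable_fun setT f -> measurable_fun setT phi ->
  (forall x, (0 <= f x)%R) -> (forall x, (0 <= phi x)%R) ->
  mu.-integrable setT (fun x => (f x)%:E) ->
  mu.-integrable setT (fun x => (g x)%:E) ->
  mu.-integrable setT (fun x : R => (x ^+ 2 * f x)%:E) ->
  mu.-integrable setT (fun x : R => (x ^+ 2 * g x)%:E) ->
  mu.-integrable setT (fun x => (g x * phi x)%:E) ->
  \int[mu]_x (f x)%:E = \int[mu]_x (g x)%:E ->
  \int[mu]_x ((x : R) ^+ 2 * f x)%:E = \int[mu]_x ((x : R) ^+ 2 * g x)%:E ->
  (forall x, f x * phi x <= g x * phi x + (al + be * x ^+ 2) * (f x - g x))%R ->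
  \int[mu]_x (f x * phi x)%:E <= \int[mu]_x (g x * phi x)%:E.
Proof.
move=> mf mphi f0 phi0 if_ ig ixf ixg igp fg xfg H.
have [i1 e1] := integral_sub_eq0 if_ ig fg.
have [i2 e2] := integral_sub_eq0 ixf ixg xfg.
have j1 := integrableZl measurableT al i1.
have j2 := integrableZl measurableT be i2.
have j := integrableD measurableT j1 j2.
have jj := integrableD measurableT igp j.
apply: (@le_trans _ _ (\int[mu]_x ((g x * phi x)%:E +
    (al%:E * ((f x)%:E - (g x)%:E) +
     be%:E * (((x : R) ^+ 2 * f x)%:E - ((x : R) ^+ 2 * g x)%:E))))).
  apply: ge0_le_integral => //.
  - by move=> x _; rewrite lee_fin mulr_ge0.
  - by apply/measurable_EFinP; exact: measurable_funM.
  - exact: measurable_int jj.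
  - move=> x _; rewrite -!EFinB -!EFinM -!EFinD lee_fin.
    by apply: le_trans (H x) _; lra.
rewrite integralD// [X in _ + X]integralD// integralZl// integralZl//.
by rewrite e1 e2 !mule0 !adde0.
Qed.

Lemma laplace_comparison f (psi : R -> R) :
  measurable_fun setT f -> (forall x, (0 <= f x)%R) -> even_fun f ->
  log_concave f -> \int[mu]_x (f x)%:E = 1 ->
  \int[mu]_x ((x : R) ^+ 2 * f x)%:E =
    \int[mu]_x ((x : R) ^+ 2 * laplace_pdf x)%:E ->
  convex_nonneg psi -> measurable_fun setT (fun x : R => psi (x ^+ 2)%R) ->
  (forall x, (0 <= psi (x ^+ 2))%R) ->
  mu.-integrable setT (fun x : R => (laplace_pdf x * psi (x ^+ 2))%:E) ->
  \int[mu]_x (f x * psi ((x : R) ^+ 2))%:E <=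
  \int[mu]_x (laplace_pdf x * psi ((x : R) ^+ 2))%:E.
Proof.
move=> mf f0 ef lf f1 f2 cpsi mpsi psi0 igp.
have g0 (x : R) : (0 <= laplace_pdf x)%R by rewrite ltW// laplace_pdf_gt0.
have mg := @measurable_laplace_pdf R.
have if_ : mu.-integrable setT (fun x => (f x)%:E).
  by apply: ge0_integrable_fin => //; rewrite f1 ltry.
have ig := integrable_laplace_pdf.
have ixf := log_concave_second_moment mf f0 ef lf f1.
have ixg := integrable_laplace_second_moment.
have fg : \int[mu]_x (f x)%:E = \int[mu]_x (laplace_pdf x)%:E.
  by rewrite f1 integral_laplace_pdf.
have [[p fp]|[a [b [a0 ab Iab nIab]]]|[a a0 H]] := log_concave_laplace_cases f0 ef lf.
(* Here [f] lies below the Laplace density off two points, so the integrals compare directly. *)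
- apply: ae_ge0_le_integral => //.
  + by move=> x _; rewrite lee_fin mulr_ge0.
  + by apply/measurable_EFinP; exact: measurable_funM.
  + by move=> x _; rewrite lee_fin mulr_ge0.
  + by apply/measurable_EFinP; exact: measurable_funM.
  + apply: ae_lebesgueS2 (ae_neq p) (ae_neq (- p)) _ => x xp xNp _.
    by rewrite lee_fin ler_wpM2r// fp.
(* The chord is taken over the squares of the crossing points: chord minus [psi] and
   [f - laplace_pdf] then always have the same sign. *)
- have a2b2 : (a ^+ 2 < b ^+ 2)%R by rewrite ltrXn2r// ?nnegrE//; lra.
  have [al [be [le ge]]] := convex_nonneg_chord cpsi (sqr_ge0 a) a2b2.
  apply: (@ge0_integral_le_of_moments _ _ (fun x => psi (x ^+ 2)%R) al be) => //.
  move=> x; rewrite -subr_ge0.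
  rewrite (_ : _ - _ = (al + be * x ^+ 2 - psi (x ^+ 2)) *
    (f x - laplace_pdf x))%R; last by ring.
  have x2 : (x ^+ 2 = `|x| ^+ 2)%R by rewrite real_normK// num_real.
  have [gf|fltg] := leP (laplace_pdf x) (f x).
    have /andP[ax xb] := Iab _ gf.
    rewrite mulr_ge0 ?subr_ge0//; apply: le; rewrite x2 lerXn2r ?nnegrE//; lra.
  rewrite mulr_le0 ?subr_le0 ?(ltW fltg)//; apply: ge; first exact: sqr_ge0.
  rewrite x2; have [xa|bx] := nIab _ fltg; [left|right];
    by rewrite lerXn2r ?nnegrE//; lra.
(* With a single crossing, [(x ^+ 2 - a ^+ 2) * (f x - laplace_pdf x)] is nonnegative with integral
   0. So [f] equals the Laplace density almost everywhere, and both sides coincide. *)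
- rewrite le_eqVlt; apply/orP; left; apply/eqP.
  have [i1 e1] := integral_sub_eq0 if_ ig fg.
  have [i2 e2] := integral_sub_eq0 ixf ixg f2.
  have j1 := integrableZl measurableT (- a ^+ 2)%R i1.
  have hE x : ((x ^+ 2 - a ^+ 2) * (f x - laplace_pdf x))%:E =
      (x ^+ 2 * f x)%:E - (x ^+ 2 * laplace_pdf x)%:E +
      (- a ^+ 2)%:E * ((f x)%:E - (laplace_pdf x)%:E).
    by rewrite -!EFinB -!EFinM -EFinD; congr EFin; ring.
  have mh : measurable_fun setT
      (fun x : R => (x ^+ 2 - a ^+ 2) * (f x - laplace_pdf x))%R.
    apply: measurable_funM; last exact: measurable_funB.
    by apply: measurable_funB => //; exact: measurable_sqr.
  have : ae_eq mu setT
      (fun x => (((x : R) ^+ 2 - a ^+ 2) * (f x - laplace_pdf x))%:E) (cst 0).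
    apply/ae_eq_integral_abs => //; first exact/measurable_EFinP.
    transitivity (\int[mu]_x (((x : R) ^+ 2 * f x)%:E -
       ((x : R) ^+ 2 * laplace_pdf x)%:E +
      (- a ^+ 2)%:E * ((f x)%:E - (laplace_pdf x)%:E))).
      by apply: eq_integral => x _; rewrite abse_EFin ger0_norm// hE.
    by rewrite integralD// integralZl// e1 e2 mule0 adde0.
  move=> hae; apply: ae_eq_integral => //.
  + by apply/measurable_EFinP; exact: measurable_funM.
  + by apply/measurable_EFinP; exact: measurable_funM.
  + have aea : {ae mu, forall x, x != a /\ (x != - a)%R}.
      exact: ae_lebesgueS2 (ae_neq a) (ae_neq (- a)) _.
    apply: ae_lebesgueS2 hae aea _ => x /(_ Logic.I) [] h [xa xNa] _ /=.
    have h2 : (x ^+ 2 - a ^+ 2 != 0)%R.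
      by rewrite subr_sqr mulf_neq0 ?subr_eq0 ?addr_eq0.
    have -> // : f x = laplace_pdf x.
    apply/eqP; rewrite -subr_eq0; move: h => /eqP.
    by rewrite mulf_eq0 (negbTE h2).
Qed.

End comparison.

(** * The one-dimensional inequality *)

Section one_dim.
Context {R : realType}.
Local Open Scope ereal_scope.
Notation mu := (@lebesgue_measure R).

Lemma measurable_laplace_cramer : measurable_fun setT (@laplace_cramer R).
Proof.
have mu_ : measurable_fun setT (fun y : R => Num.sqrt (1 + y ^+ 2)).
  apply: measurableT_comp.
    by apply: continuous_measurable_fun; exact: sqrt_continuous.
  by apply: measurable_funD => //; exact: measurable_sqr.
apply: measurable_funM.
  by apply: measurable_funM => //; exact: measurable_funD.
by apply: measurable_expR_comp; exact: measurable_funB.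
Qed.

Lemma log_concave_rescale (f : R -> R) (k : R) : (0 < k)%R ->
  (forall x, (0 <= f x)%R) -> log_concave f ->
  log_concave (fun x => f (x / k) / k)%R.
Proof.
move=> k0 f0 lf x y t t01.
have ki0 : (0 < k^-1)%R by rewrite invr_gt0.
rewrite !powRM ?f0 ?(ltW ki0)// mulrACA -powRD; last first.
  by apply/implyP => _; rewrite gt_eqF.
rewrite [X in (k^-1 `^ X)%R](_ : _ = 1%R) ?powRr1 ?(ltW ki0)//; last by lra.
rewrite ler_pM2r//; apply: le_trans (lf _ _ _ t01) _.
by rewrite le_eqVlt; apply/orP; left; apply/eqP; congr f; field; rewrite gt_eqF.
Qed.

Lemma measurable_expR_scale (c : R) : measurable_fun setT (fun x : R => expR (c * x)).
Proof. by apply: measurable_expR_comp; exact: mulrl_measurable. Qed.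

Lemma integral_laplace_expR (xi : R) : (`|xi| < 1)%R ->
  \int[mu]_x (laplace_pdf x * expR (xi * x))%:E = ((1 - xi ^+ 2)^-1)%:E.
Proof.
move=> xi1; rewrite (eq_integral (fun x : measurableTypeR R =>
    2^-1%:E * (expR (xi * x - 1 * `|x|))%:E)); last first.
  by move=> x _; rewrite -EFinM /laplace_pdf -mulrA -expRD mul1r addrC.
rewrite ge0_integralZl_EFin//; last first.
  apply/measurable_EFinP; apply: measurable_expR_comp; apply: measurable_funB.
    exact: mulrl_measurable.
  by apply: measurable_funM => //; exact: measurable_norm.
rewrite integral_expR_linear_norm// -EFinM; congr EFin.
move: xi1; rewrite ltr_norml => /andP[x1 x2].
have h1 : (1 - xi != 0)%R by rewrite gt_eqF//; lra.
have h2 : (1 + xi != 0)%R by rewrite gt_eqF//; lra.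
have -> : (1 - xi ^+ 2 = (1 - xi) * (1 + xi))%R by ring.
by field; rewrite h1 h2.
Qed.

Lemma integral_laplace_expR_pinfty (xi : R) : (1 <= `|xi|)%R ->
  \int[mu]_x (laplace_pdf x * expR (xi * x))%:E = +oo.
Proof.
move=> xi1; rewrite (eq_integral (fun x : measurableTypeR R =>
    2^-1%:E * (expR (xi * x - `|x|))%:E)); last first.
  by move=> x _; rewrite -EFinM /laplace_pdf -mulrA -expRD addrC.
rewrite ge0_integralZl_EFin//; last first.
  apply/measurable_EFinP; apply: measurable_expR_comp; apply: measurable_funB.
    exact: mulrl_measurable.
  exact: measurable_norm.
by rewrite integral_expR_linear_norm_pinfty// gt0_muley// lte_fin.
Qed.

(** The function e^(xi x) does not depend on x ^ 2 alone, but its symmetrization does; for even [f],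
    reflection makes the two integrals proportional. *)
Lemma integral_even_cosh (f : R -> R) (xi : R) : measurable_fun setT f ->
  (forall x, (0 <= f x)%R) -> even_fun f ->
  \int[mu]_x (f x * (expR (xi * x) + expR (- (xi * x))))%:E =
  2%:E * \int[mu]_x (f x * expR (xi * x))%:E.
Proof.
move=> mf f0 ef.
have mfe (c : R) : measurable_fun setT (fun x : R => f x * expR (c * x))%R.
  by apply: measurable_funM => //; exact: measurable_expR_scale.
have fe0 (c x : R) : (0 <= f x * expR (c * x))%R by rewrite mulr_ge0 ?expR_ge0.
transitivity (\int[mu]_x ((f x * expR (xi * x))%:E + (f x * expR (- xi * x))%:E)).
  by apply: eq_integral => x _; rewrite mulrDr mulNr.
rewrite ge0_integralD//; last 4 first.
- by move=> x _; rewrite lee_fin.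
- by apply/measurable_EFinP; exact: (mfe xi).
- by move=> x _; rewrite lee_fin.
- by apply/measurable_EFinP; exact: (mfe (- xi)%R).
rewrite -(ge0_integral_opp (mfe (- xi)%R))//.
rewrite [X in _ + X](_ : _ = \int[mu]_x (f x * expR (xi * x))%:E); last first.
  by apply: eq_integral => x _; rewrite ef mulrNN.
set A := \int[mu]_x _; have A0 : 0 <= A.
  by apply: integral_ge0 => x _; rewrite lee_fin.
by rewrite -[X in X + X]mul1e -ge0_muleDl.
Qed.

Lemma density_integral1 d (T : measurableType d) (P : probability T R)
    (X : T -> R) (f : R -> R) : has_density P X f -> \int[mu]_x (f x)%:E = 1.
Proof.
move=> [_ [_ Pf]]; rewrite -(@probability_setT _ _ _ P).
by rewrite -[in RHS](preimage_setT X) Pf.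
Qed.

Lemma log_concave_laplace_expR (f : R -> R) (xi : R) :
  measurable_fun setT f -> (forall x, (0 <= f x)%R) -> even_fun f ->
  log_concave f -> \int[mu]_x (f x)%:E = 1 ->
  \int[mu]_x ((x : R) ^+ 2 * f x)%:E =
    \int[mu]_x ((x : R) ^+ 2 * laplace_pdf x)%:E ->
  (`|xi| < 1)%R ->
  \int[mu]_x (f x * expR (xi * x))%:E <= ((1 - xi ^+ 2)^-1)%:E.
Proof.
move=> mf f0 ef lf f1 f2 xi1.
have coshE (x : R) : (expR (xi * Num.sqrt (x ^+ 2)) + expR (- (xi * Num.sqrt (x ^+ 2))) =
    expR (xi * x) + expR (- (xi * x)))%R.
  rewrite sqrtr_sqr; have [x0|x0] := leP 0%R x; first by rewrite ger0_norm.
  by rewrite ltr0_norm// mulrN opprK addrC.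
have mcosh : measurable_fun setT (fun x : R => expR (xi * x) + expR (- (xi * x)))%R.
  apply: measurable_funD; first exact: measurable_expR_scale.
  by under eq_fun do rewrite -mulNr; exact: measurable_expR_scale.
have g0 (x : R) : (0 <= laplace_pdf x)%R by rewrite ltW// laplace_pdf_gt0.
have mg := @measurable_laplace_pdf R.
have eg : even_fun (@laplace_pdf R) by move=> x; rewrite /laplace_pdf normrN.
have c0 (x : R) : (0 <= expR (xi * x) + expR (- (xi * x)))%R.
  by rewrite addr_ge0 ?expR_ge0.
have := @laplace_comparison R f
  (fun s => expR (xi * Num.sqrt s) + expR (- (xi * Num.sqrt s)))%R mf f0 ef lf f1 f2.
have fE (h : R -> R) : \int[mu]_x (h x * (expR (xi * Num.sqrt ((x : R) ^+ 2)) +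
      expR (- (xi * Num.sqrt ((x : R) ^+ 2)))))%:E =
    \int[mu]_x (h x * (expR (xi * x) + expR (- (xi * x))))%:E.
  by apply: eq_integral => x _; rewrite coshE.
rewrite !fE !integral_even_cosh// integral_laplace_expR//.
rewrite lee_pmul2l//; apply.
- exact: convex_nonneg_cosh_sqrt.
- by under eq_fun do rewrite coshE.
- by move=> x; rewrite coshE.
- under eq_fun do rewrite coshE.
  apply: ge0_integrable_fin.
  + exact: measurable_funM.
  + by move=> x; rewrite mulr_ge0.
  + by rewrite integral_even_cosh// integral_laplace_expR// -EFinM ltry.
Qed.

(** One factor [l] must serve both bounds: the first yields e^(- Lambda_X^* (x)) <= Phi (l x), and
    the second integrates this majorant. *)
Lemma log_concave_laplace_scale d (T : measurableType d) (P : probability T R)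
    (X : T -> R) (f : R -> R)
    d' (T' : measurableType d') (P' : probability T' R) (Y : T' -> R) :
  measurable_fun setT X -> has_density P X f -> even_fun f -> log_concave f ->
  measurable_fun setT Y -> has_density P' Y (@laplace_pdf R) ->
  exists l : R, [/\ (0 < l)%R,
    forall xi, (`|xi| < 1)%R ->
      \int[P]_w (expR (xi * (l * X w)))%:E <= ((1 - xi ^+ 2)^-1)%:E &
    \int[P]_w (laplace_cramer (l * X w))%:E <=
    \int[P']_w (laplace_cramer (Y w))%:E].
Proof.
move=> mX Pf ef lf mY PY; have [mf [f0 _]] := Pf.
have f1 := density_integral1 Pf.
have g0 (x : R) : (0 <= laplace_pdf x)%R by rewrite ltW// laplace_pdf_gt0.
have mg := @measurable_laplace_pdf R.
have imX := log_concave_second_moment mf f0 ef lf f1.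
have mX0 := second_moment_gt0 mf f0 f1.
have imY := @integrable_laplace_second_moment R.
have mY0 := second_moment_gt0 mg g0 (@integral_laplace_pdf R).
have := integrable_fin_num measurableT imX.
have := integrable_fin_num measurableT imY.
move: mX0 mY0; set MX := \int[mu]_x _; set MY := \int[mu]_x _.
move=> mX0 mY0 MYfin MXfin.
have mx0 : (0 < fine MX)%R by rewrite fine_gt0// mX0/= ltey_eq MXfin.
have my0 : (0 < fine MY)%R by rewrite fine_gt0// mY0/= ltey_eq MYfin.
(* This choice gives [l * X] the second moment [MY] of the Laplace law. *)
pose l := Num.sqrt (fine MY / fine MX).
have l0 : (0 < l)%R by rewrite sqrtr_gt0 divr_gt0.
have mlX : measurable_fun setT (fun w => l * X w)%R.
  exact: measurable_funM.
have PlX := has_density_scale l0 mX Pf.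
set fl := (fun x => f (x / l) / l)%R in PlX.
have [mfl [fl0 _]] := PlX.
have fl1 := density_integral1 PlX.
have efl : even_fun fl by move=> x; rewrite /fl mulNr ef.
have lfl : log_concave fl by exact: log_concave_rescale.
have fl2 : \int[mu]_x ((x : R) ^+ 2 * fl x)%:E =
    \int[mu]_x ((x : R) ^+ 2 * laplace_pdf x)%:E.
  transitivity (\int[P]_w ((l * X w) ^+ 2)%:E).
    rewrite (ge0_expectation_density (phi := fun x => (x ^+ 2)%R) mlX PlX).
    - by apply: eq_integral => x _; rewrite mulrC.
    - exact: measurable_sqr.
    - by move=> x; exact: sqr_ge0.
  transitivity (\int[P]_w ((l ^+ 2)%:E * (X w ^+ 2)%:E)).
    by apply: eq_integral => w _; rewrite exprMn.
  rewrite ge0_integralZl_EFin ?sqr_ge0//; last first.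
  - apply/measurable_EFinP; apply: (measurableT_comp measurable_sqr mX).
  - by move=> w _; rewrite lee_fin sqr_ge0.
  rewrite (ge0_expectation_density (phi := fun x => (x ^+ 2)%R) mX Pf).
  - rewrite (eq_integral (fun x : measurableTypeR R => ((x : R) ^+ 2 * f x)%:E)); last first.
      by move=> x _; rewrite mulrC.
    rewrite -/MX -/MY -(fineK MXfin) -(fineK MYfin) -EFinM; congr EFin.
    by rewrite sqr_sqrtr ?divr_ge0 ?ltW//; field; rewrite gt_eqF.
  - exact: measurable_sqr.
  - by move=> x; exact: sqr_ge0.
exists l; split => // [xi xi1|].
  rewrite (ge0_expectation_density (phi := fun x => expR (xi * x)) mlX PlX).
  - exact: log_concave_laplace_expR.
  - exact: measurable_expR_scale.
  - by move=> x; exact: expR_ge0.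
have mPhi := measurable_laplace_cramer.
have Phi0 := @laplace_cramer_ge0 R.
rewrite (ge0_expectation_density mlX PlX)// (ge0_expectation_density mY PY)//.
apply: (laplace_comparison (psi := fun s => (1 + Num.sqrt (1 + s)) / 2 *
  expR (1 - Num.sqrt (1 + s))%R)%R) => //.
- exact: convex_nonneg_laplace_cramer.
- apply: ge0_integrable_fin.
  + exact: measurable_funM.
  + by move=> x; rewrite mulr_ge0.
  + apply: (@le_lt_trans _ _ (\int[mu]_x (laplace_pdf x)%:E)).
      apply: ge0_le_integral => //.
      * by move=> x _; rewrite lee_fin mulr_ge0.
      * by apply/measurable_EFinP; exact: measurable_funM.
      * exact/measurable_EFinP.
      * by move=> x _; rewrite lee_fin ler_piMr// laplace_cramer_le1.
    by rewrite integral_laplace_pdf ltry.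
Qed.

End one_dim.

(** * Cramer transforms *)

Section cramer.
Context {R : realType}.
Local Open Scope ereal_scope.

Lemma laplace_cramer_gt0 (y : R) : (0 < laplace_cramer y)%R.
Proof.
by rewrite mulr_gt0 ?expR_gt0// divr_gt0.
Qed.

(** For [b = 0] both sides are 0, through the conventions log 0 = -oo and exp (-oo) = 0. *)
Lemma expeR_sub_lne (a b : R) : (0 <= b)%R ->
  expeR (- (a%:E - lne b%:E)) = (expR (- a) * b)%:E.
Proof.
move=> b0 /=; case: ifPn => [b0'|]; last first.
  rewrite -ltNge => bgt /=; by rewrite opprB addrC expRD lnK ?posrE.
by rewrite (_ : b = 0%R) ?mulr0//; apply/eqP; rewrite eq_le b0'.
Qed.

(** Every [xi] must be controlled in the supremum: for [|s| < 1] by [laplace_cramer_le], while for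
    [|s| >= 1] the Laplace transform is infinite and the term is -oo. *)
Lemma laplace_cramer_le_cramer d (T : measurableType d) (P : probability T R)
    (Y : T -> R) (y : R) :
  measurable_fun setT Y -> has_density P Y (@laplace_pdf R) ->
  (laplace_cramer y)%:E <= expeR (- cramer P (fun _ : 'I_1 => Y) (fun=> y)).
Proof.
move=> mY PY.
have -> : (laplace_cramer y)%:E = expeR (- (- ln (laplace_cramer y))%:E).
  by rewrite /= opprK lnK// posrE laplace_cramer_gt0.
rewrite lee_expeR leeN2; apply: ge_ereal_sup => _ [xi _ <-].
rewrite /dotn /log_laplace big_ord1 expectation.unlock.
set s := xi ord0.
rewrite (_ : \int[P]_w _ = \int[lebesgue_measure]_x
    (laplace_pdf x * expR (s * x))%:E); last first.
  rewrite -(ge0_expectation_density (phi := fun x => expR (s * x)) mY PY).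
  - by apply: eq_integral => w _; rewrite /dotn big_ord1 mulrC.
  - exact: measurable_expR_scale.
  - by move=> x; exact: expR_ge0.
have [s1|s1] := ltP `|s|%R 1%R; last first.
  by rewrite integral_laplace_expR_pinfty//= leNye.
have s2 : (0 < 1 - s ^+ 2)%R.
  by rewrite subr_gt0 -[(s ^+ 2)%R]real_normK ?num_real// exprn_ilt1.
rewrite integral_laplace_expR// lne_EFin ?invr_gt0// -EFinB lee_fin.
rewrite lnV ?posrE// opprK lerNr.
rewrite -ler_expR lnK ?posrE ?laplace_cramer_gt0//.
by rewrite opprD expRD expRN expRN lnK ?posrE// -expRN laplace_cramer_le.
Qed.

(** One test vector suffices to bound the supremum from below. Its coordinates are [l i * s i], with
    [s i] optimal for the double exponential law at [l i * x i]; independence factors the Laplace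
    transform at this vector. *)
Lemma expeR_cramer_le d (T : measurableType d) (P : probability T R) n
    (X : 'I_n -> T -> R) (l : 'I_n -> R) (x : 'I_n -> R) :
  (forall i, measurable_fun setT (X i)) -> mutually_independent P X ->
  (forall i xi, (`|xi| < 1)%R ->
      \int[P]_w (expR (xi * (l i * X i w)))%:E <= ((1 - xi ^+ 2)^-1)%:E) ->
  expeR (- cramer P X x) <= (\prod_i laplace_cramer (l i * x i))%R%:E.
Proof.
move=> mX indX lX.
have /choice[s sP] : forall i, exists s, (`|s| < 1)%R /\
    laplace_cramer (l i * x i) = (expR (- (l i * x i * s)) * (1 - s ^+ 2)^-1)%R.
  by move=> i; have [s s1 sE] := laplace_cramer_exists (l i * x i); exists s.
pose u i (z : R) := expR (s i * (l i * z)).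
have mu i : measurable_fun setT (u i).
  rewrite /u; under eq_fun do rewrite mulrA; exact: measurable_expR_scale.
have u0 i z : (0 <= u i z)%R by exact: expR_ge0.
have lXi i := lX i (s i) (sP i).1.
have I0 i : 0 <= \int[P]_w (u i (X i w))%:E.
  by apply: integral_ge0 => w _; rewrite lee_fin.
pose e i := fine (\int[P]_w (u i (X i w))%:E).
have eE i : \int[P]_w (u i (X i w))%:E = (e i)%:E.
  by rewrite fineK// ge0_fin_numE// (le_lt_trans (lXi i)) ?ltry.
have e0 i : (0 <= e i)%R by rewrite fine_ge0.
have prodE := expectation_prod_independent mX indX mu u0 eE.
pose xi i := (l i * s i)%R.
apply: (@le_trans _ _ (expeR (- ((dotn x xi)%:E - log_laplace P X xi)))).
  by rewrite lee_expeR leeN2; apply: ereal_sup_ubound; exists xi.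
rewrite /log_laplace expectation.unlock.
rewrite (_ : \int[P]_w _ = (\prod_i e i)%R%:E); last first.
  rewrite -prodE; apply: eq_integral => w _; rewrite /dotn expR_sum.
  by congr EFin; apply: eq_bigr => i _; rewrite /u /xi; congr expR; ring.
rewrite expeR_sub_lne ?prodr_ge0// lee_fin /dotn -sumrN expR_sum -big_split/=.
apply: ler_prod => i _; rewrite mulr_ge0 ?expR_ge0//= (sP i).2 /xi.
rewrite (_ : - (x i * (l i * s i)) = - (l i * x i * s i))%R; last by ring.
by rewrite ler_wpM2l ?expR_ge0// -lee_fin -eE; exact: lXi.
Qed.

End cramer.

(** * Tensorization over the independent coordinates *)

Theorem theorem1p3 (R : realType) (n : nat)
    (d : measure_display) (T : measurableType d) (P : probability T R)
    (X : 'I_n -> T -> R)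
    (d' : measure_display) (T' : measurableType d') (P' : probability T' R)
    (Y : T' -> R) :
  (forall i, measurable_fun setT (X i)) ->
  mutually_independent P X ->
  (forall i, exists f : R -> R,
      has_density P (X i) f /\ even_fun f /\ log_concave f) ->
  measurable_fun setT Y ->
  has_density P' Y (fun y => 2^-1 * expR (- `|y|)) ->
  (cramer_functional P X <=
     (cramer_functional P' (fun _ : 'I_1 => Y)) ^+ n)%E.
Proof.
move=> mX indX fX mY PY.
have /choice[l lP] i : exists l : R,
    (forall xi, `|xi| < 1 ->
      (\int[P]_w (expR (xi * (l * X i w)))%:E <= ((1 - xi ^+ 2)^-1)%:E)%E) /\
    (\int[P]_w (laplace_cramer (l * X i w))%:E <=
     \int[P']_w (laplace_cramer (Y w))%:E)%E.
  have [f [Pf [ef lf]]] := fX i.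
  by have [l [_ h1 h2]] := log_concave_laplace_scale (mX i) Pf ef lf mY PY; exists l.
have mPhi := @measurable_laplace_cramer R.
have Phi0 := @laplace_cramer_ge0 R.
(* Since Phi <= 1 these expectations are finite, so the product formula can be applied with real
   values [c i]. *)
have int_le1 d0 (S : measurableType d0) (Q : probability S R) (Z : S -> R) :
    measurable_fun setT Z -> (\int[Q]_w (laplace_cramer (Z w))%:E)%E \is a fin_num.
  move=> mZ; rewrite ge0_fin_numE; last first.
    by apply: integral_ge0 => w _; rewrite lee_fin.
  apply: (@le_lt_trans _ _ (\int[Q]_w cst 1 w)%E); last first.
    have Q1 : Q setT = 1%E by exact: probability_setT.
    by rewrite integral_cst// mul1e [ltLHS]Q1 ltry.
  apply: ge0_le_integral => //.
  - by move=> w _; rewrite lee_fin.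
  - by apply/measurable_EFinP; exact: measurableT_comp.
  - by move=> w _; rewrite lee_fin laplace_cramer_le1.
have mlX i : measurable_fun setT (fun w => l i * X i w) by exact: measurable_funM.
pose q := fine (\int[P']_w (laplace_cramer (Y w))%:E)%E.
have qE : (\int[P']_w (laplace_cramer (Y w))%:E)%E = q%:E by rewrite fineK// int_le1.
pose c i := fine (\int[P]_w (laplace_cramer (l i * X i w))%:E)%E.
have cE i : (\int[P]_w (laplace_cramer (l i * X i w))%:E)%E = (c i)%:E.
  by rewrite fineK// int_le1.
have c0 i : 0 <= c i.
  by rewrite -lee_fin -cE; apply: integral_ge0 => w _; rewrite lee_fin.
have cq i : c i <= q by rewrite -lee_fin -cE -qE; exact: (lP i).2.
(* The pivot is q ^ n with q = E Phi (Y). On the side of [Y] the inequality Phi <= e^(- Lambda_Y^* )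
   is enough. *)
apply: (@le_trans _ _ (q%:E ^+ n)%E); last first.
  have q0 : (0 <= q%:E)%E.
    by rewrite -qE; apply: integral_ge0 => w _; rewrite lee_fin.
  have qY : (q%:E <= cramer_functional P' (fun _ : 'I_1 => Y))%E.
    rewrite -qE; apply: ge0_le_integral_nomeas => w; first by rewrite lee_fin.
    exact: laplace_cramer_le_cramer.
  elim: n {X mX indX fX l lP mlX c cE c0 cq} => [//|n IH].
  by rewrite !expeS lee_pmul// expe_ge0.
(* On the side of [X] the integrand is bounded by a product of one-coordinate functions, whose
   expectation factors into the [c i], each at most [q]. *)
apply: (@le_trans _ _ (\int[P]_w (\prod_i laplace_cramer (l i * X i w))%R%:E)%E).
  apply: ge0_le_integral_nomeas => w; first exact: expeR_ge0.
  by apply: expeR_cramer_le => // i; exact: (lP i).1.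
rewrite (expectation_prod_independent (u := fun i x => laplace_cramer (l i * x))
  mX indX _ _ cE)//; last first.
  move=> i; apply: measurableT_comp => //; exact: mulrl_measurable.
rewrite -EFin_expe lee_fin -[in leRHS](card_ord n) -prodr_const.
by apply: ler_prod => i _; rewrite c0 cq.
Qed.
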